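(* Let $\lambda$ be a frequency and $X$ a Banach space. If $\mathcal{H}_p(\lambda,X)=\mathcal{H}_p^+(\lambda,X)$ for some $1\le p\le\infty$, then $X$ contains no isomorphic copy of $c_0$.
   Context: Banach spaces are complex. A frequency is a strictly increasing sequence $\lambda=(\lambda_n)_{n\ge 1}$ of non-negative real numbers with $\lambda_n\to\infty$. Formal $\lambda$-Dirichlet series are $D=\sum a_n e^{-\lambda_n s}$ with coefficients $a_n\in X$. Dirichlet groups: a pair $(G,\beta)$ is a Dirichlet group if $G$ is a compact abelian group and $\beta:\mathbb{R}\to G$ is a continuous homomorphism with dense range. It is a $\lambda$-Dirichlet group if for every $n$ there is a (necessarily unique) character $h_{\lambda_n}\in\widehat G$ with $h_{\lambda_n}(\beta(t))=e^{-i\lambda_n t}$ for all $t\in\mathbb{R}$. Every frequency admits a $\lambda$-Dirichlet group. With $m$ the normalized Haar measure and $\widehat f(\gamma)=\int_G f\,\overline{\gamma}\,dm$, let $H_p^\lambda(G,X)$ be the space of all $f\in L_p(G,X)$ (Bochner space) with $\widehat f(\gamma)=0$ unless $\gamma=h_{\lambda_n}$ for some $n$. $\mathcal{H}_p(\lambda,X)$: all $D=\sum a_ne^{-\lambda_n s}$ for which there is a (necessarily unique) $f\in H_p^\lambda(G,X)$ with $\widehat f(h_{\lambda_n})=a_n$ for all $n$, with norm $\|D\|_p:=\|f\|_p$. This does not depend on the chosen $\lambda$-Dirichlet group. $\mathcal{H}_p^+(\lambda,X)$: all formal $D=\sum a_ne^{-\lambda_n s}$ such that $D_\sigma:=\sum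 a_ne^{-\sigma\lambda_n}e^{-\lambda_n s}\in\mathcal{H}_p(\lambda,X)$ for all $\sigma>0$ and $\|D\|_p^+:=\sup_{\sigma>0}\|D_\sigma\|_p<\infty$. *)

(* Defs.v *)
From HB Require Import structures.
From mathcomp Require Import all_boot all_order all_algebra.
From mathcomp Require Import all_classical all_reals all_analysis.
From mathcomp Require Import complex.

Set Implicit Arguments.
Unset Strict Implicit.
Unset Printing Implicit Defensive.

Import Order.TTheory GRing.Theory Num.Theory.
Import numFieldNormedType.Exports.

Local Open Scope classical_set_scope.
Local Open Scope ring_scope.

(* The canonical topology of a [numClosedFieldType] is keyed on that structure,
   not on the bare type [R[i]]; this name is convertible to [R[i]] and carries
   both. *)
Notation Cplx R := (Num.ClosedField.sort (R[i] : numClosedFieldType)).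

(* Norms of complex normed spaces take their values in the nonnegative reals of
   [R[i]]; [rnorm] is the same number as an element of [R]. *)
Definition rnorm {R : realType} {X : normedModType (Cplx R)} (x : X) : R :=
  complex.Re `|x|.

Section c0_space.
Variable K : numFieldType.
Definition c0_seq : {pred nat -> K} :=
  [pred u : nat -> K | `[< u @ \oo --> (0 : K) >]].
Lemma c0_seqP (u : nat -> K) : reflect (u @ \oo --> (0 : K)) (u \in c0_seq).
Proof. exact: asboolP. Qed.
Lemma c0_submod_closed : submod_closed c0_seq.
Proof.
split; first by apply/c0_seqP; exact: cvg_cst.
move=> a u v /c0_seqP u0 /c0_seqP v0; apply/c0_seqP.
have -> : (0 : K) = a *: (0:K) + 0 by rewrite scaler0 addr0.
apply: (@cvgD K K^o) => //.
exact: (@cvgZl_tmp K K^o).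
Qed.
HB.instance Definition _ :=
  GRing.isSubmodClosed.Build K (nat -> K) c0_seq c0_submod_closed.

Record c0 := C0 { c0_val :> nat -> K; c0_valP : c0_val \in c0_seq }.
HB.instance Definition _ := [isSub for c0_val].
HB.instance Definition _ := [Choice of c0 by <:].
HB.instance Definition _ := [SubChoice_isSubLmodule of c0 by <:].
End c0_space.
Section c0_norm.
Variable R : realType.
Local Notation C := (Cplx R).
Implicit Types u v : c0 C.

Definition c0_norm u : R := sup (range (fun n => rnorm (u n : C^o))).

Lemma RnormE (z : C) : ((complex.Re `|z|)%:C)%C = `|z|.
Proof. by apply: RRe_real; exact: normr_real. Qed.

Lemma has_sup_c0 u : has_sup (range (fun n => rnorm (u n : C^o))).
Proof.
split; first by exists (rnorm (u 0%N : C^o)), 0%N.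
have /(c0_seqP (K:=C)) u0 := c0_valP u.
have /(cvg_seq_bounded (K:=C) (V:=C^o)) [M [Mreal HM]] : cvgn (c0_val u : nat -> C^o) by exact: cvgP u0.
have M1 : M < `|M| + 1 by rewrite (le_lt_trans (real_ler_norm Mreal))// ltrDl.
exists (complex.Re (`|M| + 1)) => _ [n _ <-].
have := HM _ M1 n Logic.I.
rewrite /rnorm -[X in X <= _ -> _]RnormE.
by rewrite lecE => /andP[].
Qed.

Lemma le_c0_norm u n : rnorm (u n : C^o) <= c0_norm u.
Proof. by apply: ub_le_sup; [exact: (has_sup_c0 u).2|exists n]. Qed.

Lemma c0_norm_le u (M : R) : (forall n, rnorm (u n : C^o) <= M) -> c0_norm u <= M.
Proof.
by move=> uM; apply: ge_sup; [exact: (has_sup_c0 u).1|move=> _ [n _ <-]].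
Qed.

Let c0_normC u : C := (c0_norm u)%:C%C.

Lemma c0_normC_ler_normD u v : c0_normC (u + v) <= c0_normC u + c0_normC v.
Proof.
rewrite /c0_normC -rmorphD/= lecR; apply: c0_norm_le => n.
rewrite (le_trans _ (lerD (le_c0_norm u n) (le_c0_norm v n)))//.
rewrite /rnorm -raddfD/=; have := ler_normD (u n) (v n).
by rewrite lecE => /andP[].
Qed.

Lemma c0_norm_ge0 u : 0 <= c0_norm u.
Proof.
apply: le_trans (le_c0_norm u 0%N); rewrite /rnorm.
by have := normr_ge0 (u 0%N); rewrite lecE => /andP[].
Qed.

Lemma rnormM (z w : C) : rnorm (z * w : C^o) = rnorm (z : C^o) * rnorm (w : C^o).
Proof.
apply: (@complexI R); rewrite rmorphM/= /rnorm.
by rewrite !RnormE normrM.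
Qed.

Lemma rnorm_ge0 (z : C) : 0 <= rnorm (z : C^o).
Proof. by have := normr_ge0 z; rewrite lecE => /andP[]. Qed.

Lemma c0_norm_leZ (a : C) u : c0_norm (a *: u) <= rnorm (a : C^o) * c0_norm u.
Proof.
apply: c0_norm_le => n.
have -> : (a *: u) n = a * u n by [].
by rewrite rnormM ler_wpM2l ?rnorm_ge0 ?le_c0_norm.
Qed.

Lemma c0_normC_Z (a : C) u : c0_normC (a *: u) = `|a| * c0_normC u.
Proof.
rewrite -RnormE -rmorphM; congr (_ %:C)%C.
apply/eqP; rewrite eq_le c0_norm_leZ andTb.
have [->|a0] := eqVneq a 0.
  by rewrite [X in X * _](_ : _ = rnorm (0 : C^o))// /rnorm normr0 mul0r c0_norm_ge0.
have := c0_norm_leZ a^-1 (a *: u).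
rewrite scalerA mulVf// scale1r => /(ler_wpM2l (rnorm_ge0 a)).
by rewrite mulrA -rnormM mulfV// {2}/rnorm normr1/= mul1r.
Qed.

Lemma c0_normC_eq0 u : c0_normC u = 0 -> u = 0.
Proof.
move=> /(congr1 (@complex.Re R))/= u0; apply: val_inj; apply/funext => n.
have un0 : rnorm (u n : C^o) = 0.
  by apply/eqP; rewrite eq_le rnorm_ge0 andbT -u0 le_c0_norm.
by apply: normr0_eq0; rewrite -RnormE; exact: (congr1 (fun r => r%:C%C) un0).
Qed.

HB.instance Definition _ := Lmodule_isNormed.Build C (c0 C)
  c0_normC_ler_normD c0_normC_Z c0_normC_eq0.
End c0_norm.


Definition contains_copy (K : numFieldType) (Y X : normedModType K) : Prop :=
  exists T : {linear Y -> X}, exists c1 c2 : K,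
    [/\ 0 < c1, 0 < c2 &
        forall y, c1 * `|y| <= `|T y| /\ `|T y| <= c2 * `|y|].

Section bochner.
Context (R : realType) (X : completeNormedModType (Cplx R)).
Context d (T : measurableType d) (P : probability T R).
Implicit Types (s f : T -> X) (v : X).

Definition simple_fun s : Prop :=
  finite_set (range s) /\ forall x, measurable (s @^-1` [set x]).

Definition simple_integral s : X :=
  \sum_(x \in range s) ((fine (P (s @^-1` [set x])))%:C)%C *: x.

Definition strongly_measurable f : Prop :=
  exists s_ : nat -> T -> X, (forall n, simple_fun (s_ n)) /\
    {ae P, forall t, s_ n t @[n --> \oo] --> f t}.

Definition has_bochner_integral f v : Prop :=
  exists s_ : nat -> T -> X,
    [/\ forall n, simple_fun (s_ n),
        {ae P, forall t, s_ n t @[n --> \oo] --> f t},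
        (\int[P]_t (rnorm (f t - s_ n t))%:E)%E @[n --> \oo] --> 0%E &
        simple_integral (s_ n) @[n --> \oo] --> v].

(* At most one [v] qualifies; the value is [0] when [f] is not integrable. *)
Definition bochner_integral f : X := xget 0 [set v | has_bochner_integral f v].

Definition bochner_norm (p : \bar R) f : \bar R :=
  Lnorm P p (fun t => (rnorm (f t))%:E).

(* Functions rather than classes modulo almost everywhere equality. *)
Definition bochner_Lp (p : \bar R) : set (T -> X) :=
  [set f | strongly_measurable f /\ (bochner_norm p f < +oo)%E].

End bochner.

(* Measurable types are pointed: a group is pointed by its neutral element. *)
Definition pointed_at0 (G : topologicalZmodType) : Type := G.
HB.instance Definition _ (G : topologicalZmodType) := Topological.on (pointed_at0 G).
HB.instance Definition _ (G : topologicalZmodType) :=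
  isPointed.Build (pointed_at0 G) (0 : G).

Notation borel G := (g_sigma_algebraType (@open (pointed_at0 G))).

Section dirichlet_group.
Context (R : realType) (G : topologicalZmodType).
Local Notation C := (Cplx R).

(* On a compact Hausdorff group that is not second countable, a translation
   invariant Borel probability is the Haar measure only if it is regular. *)
Definition is_haar (m : probability (borel G) R) : Prop :=
  (forall (x : G) (A : set (borel G)), measurable A ->
     m [set y : G | A (x + y)] = m A) /\
  (forall A : set (borel G), measurable A ->
     m A = ereal_inf [set m U | U in [set U : set G | open U /\ A `<=` U]]).

Definition is_character (gamma : G -> C) : Prop :=
  [/\ continuous gamma,
      {morph gamma : x y / x + y >-> x * y} &
      forall x, `|gamma x| = 1].

Definition is_dirichlet_group (beta : R -> G) : Prop :=
  [/\ compact [set: G], hausdorff_space G, continuous beta,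
      {morph beta : s t / s + t} & dense (range beta)].

(* [h] is the character h_l, characterised by h_l (beta t) = exp (- i l t). *)
Definition is_freq_character (beta : R -> G) (l : R) (h : G -> C) : Prop :=
  is_character h /\
  forall t, h (beta t) = (cos (l * t) -i* sin (l * t))%C.

Definition is_lambda_dirichlet_group (lambda : nat -> R) (beta : R -> G) :=
  is_dirichlet_group beta /\
  forall n, exists h, is_freq_character beta (lambda n) h.

End dirichlet_group.

Definition is_frequency (R : realType) (lambda : nat -> R) : Prop :=
  [/\ {homo lambda : n k / (n < k)%N >-> n < k},
      forall n, 0 <= lambda n & lambda @ \oo --> +oo].

(* A formal Dirichlet series is represented by its sequence of coefficients. *)
Section dirichlet_spaces.
Context (R : realType) (X : completeNormedModType (Cplx R)).
Context (lambda : nat -> R) (G : topologicalZmodType).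
Context (beta : R -> G) (m : probability (borel G) R) (p : \bar R).
Implicit Types (f : G -> X) (a : nat -> X).

Definition fourier_coef f (gamma : G -> Cplx R) : X :=
  bochner_integral m (fun x => (gamma x)^* *: f x).

Definition Hp_group : set (G -> X) :=
  [set f | bochner_Lp m p f /\
    forall gamma : G -> Cplx R, is_character gamma ->
      (forall n, ~ is_freq_character beta (lambda n) gamma) ->
      fourier_coef f gamma = 0].

Definition Hp_representative a : set (G -> X) :=
  [set f | Hp_group f /\
    forall n h, is_freq_character beta (lambda n) h -> fourier_coef f h = a n].

Definition Hp : set (nat -> X) :=
  [set a | exists f, Hp_representative a f].

(* All representatives of [a] are almost everywhere equal, so the infimum is
   over a single value when [Hp a] holds. *)
Definition Hp_norm a : \bar R :=
  ereal_inf [set bochner_norm m p f | f in Hp_representative a].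

Definition translate (sigma : R) a : nat -> X :=
  fun n => ((expR (- (sigma * lambda n)))%:C)%C *: a n.

Definition Hp_plus_norm a : \bar R :=
  ereal_sup [set Hp_norm (translate sigma a) | sigma in [set s : R | 0 < s]].

Definition Hp_plus : set (nat -> X) :=
  [set a | (forall sigma, 0 < sigma -> Hp (translate sigma a)) /\
           (Hp_plus_norm a < +oo)%E].

End dirichlet_spaces.

(* Main.v *)
Require Import Defs.
From HB Require Import structures.
From mathcomp Require Import all_boot all_order all_algebra.
From mathcomp Require Import all_classical all_reals all_analysis.
From mathcomp Require Import measurable_realfun.
From mathcomp Require Import complex ring.

(** Suppose [T] embeds [c0] in [X], and take the coefficients [a_k = T e_k].
    The sequence [(exp (- sigma lambda_k) h_k t)_k] lies in the unit ball of
    [c0] for all [sigma > 0] and [t], so that its image under [T] is a function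
    of [t] bounded by the norm of [T], whose Fourier coefficients are those of
    [D_sigma]; hence [D] is in [H_p^+]. But [D] is not in [H_p]: its
    coefficients are bounded away from [0], whereas the Fourier coefficients of
    an integrable [f] at the [h_n] tend to [0]. Indeed, with
    [t_n = pi / (lambda_n - lambda_0)], translation by [beta t_n] changes the
    sign of [(h_n)^* h_0] while it barely moves [(h_0)^* f] in mean, because
    [beta t_n --> 0]. *)

Set Implicit Arguments.
Unset Strict Implicit.
Unset Printing Implicit Defensive.

Import Order.TTheory GRing.Theory Num.Theory.
Import numFieldNormedType.Exports.

Local Open Scope classical_set_scope.
Local Open Scope ring_scope.

(** * The real-valued norm *)

Section rnorm_theory.
Context {R : realType} {X : normedModType (Cplx R)}.
Local Notation C := (Cplx R).
Implicit Types x y : X.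

Lemma rnormE x : ((rnorm x)%:C)%C = `|x|.
Proof. by apply: RRe_real; exact: normr_real. Qed.

Lemma rnorm_nonneg x : 0 <= rnorm x.
Proof. by rewrite -lecR rnormE; exact: normr_ge0. Qed.

Lemma rnorm_lt_normC x (r : R) : (rnorm x < r) = (`|x| < (r%:C)%C).
Proof. by rewrite -rnormE ltcR. Qed.

Lemma rnorm_triangle x y : rnorm (x + y) <= rnorm x + rnorm y.
Proof. by rewrite -lecR rmorphD/= !rnormE ler_normD. Qed.

Lemma rnormZ (a : C) x : rnorm (a *: x) = rnorm (a : C^o) * rnorm x.
Proof. by apply: (@complexI R); rewrite rmorphM/= !rnormE normrZ. Qed.

Lemma rnorm_distC x y : rnorm (x - y) = rnorm (y - x).
Proof. by rewrite /rnorm distrC. Qed.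

Lemma rnorm_zero : rnorm (0 : X) = 0.
Proof. by rewrite /rnorm normr0. Qed.

Lemma rnorm_eq0 x : rnorm x = 0 -> x = 0.
Proof. by move=> x0; apply: normr0_eq0; rewrite -rnormE x0. Qed.

Lemma rnorm_dist_triangle (z x y : X) : rnorm (x - y) <= rnorm (x - z) + rnorm (z - y).
Proof. by rewrite (le_trans _ (rnorm_triangle _ _))// addrA subrK. Qed.

Lemma le_rnorm_dist x y : `|rnorm x - rnorm y| <= rnorm (x - y).
Proof.
have H (u v : X) : rnorm u - rnorm v <= rnorm (u - v).
  by rewrite lerBlDr (le_trans _ (rnorm_triangle _ _))// subrK.
by rewrite ler_norml H andbT lerNl opprB rnorm_distC H.
Qed.

Lemma cvg_rnormP (U : Type) (F : set_system U) (FF : Filter F) (f : U -> X) l :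
  f @ F --> l <-> (forall e : R, 0 < e -> \forall u \near F, rnorm (f u - l) < e).
Proof.
split => [/cvgrPdist_lt fl e e0|H].
  have := fl (e%:C)%C; rewrite ltcR => /(_ e0); apply: filterS => u.
  by rewrite distrC -rnorm_lt_normC.
apply/cvgrPdist_lt => e e0.
have [r er] : exists r : R, e = (r%:C)%C.
  by exists (complex.Re e); rewrite RRe_real// gtr0_real.
move: e0; rewrite er ltcR => /H; apply: filterS => u.
by rewrite distrC -rnorm_lt_normC.
Qed.

Lemma cvg_rnorm (U : Type) (F : set_system U) (FF : Filter F) (f : U -> X) l :
  f @ F --> l -> rnorm (f u) @[u --> F] --> rnorm l.
Proof.
move=> /cvg_rnormP fl; apply/cvgrPdist_lt => e /fl; apply: filterS => u.
by apply: le_lt_trans; rewrite distrC le_rnorm_dist.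
Qed.

Lemma rnorm_sum (I : Type) (r : seq I) (F : I -> X) :
  rnorm (\sum_(i <- r) F i) <= \sum_(i <- r) rnorm (F i).
Proof.
elim/big_ind2 : _ => [|x a y b xa yb|//]; first by rewrite rnorm_zero.
by rewrite (le_trans (rnorm_triangle _ _))// lerD.
Qed.

End rnorm_theory.

Lemma rnorm_realC (R : realType) (r : R) : 0 <= r -> rnorm ((r%:C)%C : (Cplx R)^o) = r.
Proof.
by move=> r0; rewrite /rnorm ger0_norm// lecR.
Qed.

Lemma fine_fsum (R : realType) (I : choiceType) (A : set I) (F : I -> \bar R) :
  finite_set A -> (forall i, A i -> F i \is a fin_num) ->
  fine (\sum_(i \in A) F i)%E = \sum_(i \in A) fine (F i).
Proof.
move=> fA FA; rewrite !fsbig_finite//= big_seq [RHS]big_seq sum_fine// => i.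
by rewrite in_fset_set// => Ai; apply: FA; exact: set_mem Ai.
Qed.

(** * Measurable functions with finitely many values *)

Section finite_valued.
Context d (T : measurableType d).

(** For a normed space [Y] this is [simple_fun]. An arbitrary target allows pairs, so that a
    pointwise operation on two simple functions becomes a composition with a function of pairs. *)
Definition finite_valued (Y : Type) (s : T -> Y) : Prop :=
  finite_set (range s) /\ forall y, measurable (s @^-1` [set y]).

Lemma finite_valued_preimage (Y : Type) (s : T -> Y) (A : set Y) :
  finite_valued s -> measurable (s @^-1` A).
Proof.
move=> [fs ms].
have -> : s @^-1` A = \bigcup_(y in range s `&` A) (s @^-1` [set y]).
  by apply/seteqP; split=> t /=; [move=> At; exists (s t) => //; split=> //; exists t|move=> [y [_ Ay] ->]].
by apply: fin_bigcup_measurable => // ; apply: sub_finite_set fs => ? [].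
Qed.

Lemma finite_valued_comp (Y Z : Type) (s : T -> Y) (g : Y -> Z) :
  finite_valued s -> finite_valued (g \o s).
Proof.
move=> fs; split; last by move=> z; exact: (finite_valued_preimage (g @^-1` [set z]) fs).
apply: (@sub_finite_set _ _ (g @` range s)); last exact: finite_image fs.1.
by move=> _ [t _ <-]; exists (s t) => //; exists t.
Qed.

Lemma finite_valued_pair (Y Z : Type) (s : T -> Y) (r : T -> Z) :
  finite_valued s -> finite_valued r -> finite_valued (fun t => (s t, r t)).
Proof.
move=> fs fr; split.
  by apply: sub_finite_set (finite_setX fs.1 fr.1) => _ [t _ <-]; split; exists t.
move=> [y z].
rewrite (_ : _ @^-1` _ = (s @^-1` [set y]) `&` (r @^-1` [set z])).
  by apply: measurableI; [exact: fs.2|exact: fr.2].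
by apply/seteqP; split => t /= [-> ->].
Qed.

Lemma finite_valued_cst (Y : Type) (y : Y) : finite_valued (fun _ : T => y).
Proof.
split; first by apply: sub_finite_set (finite_set1 y) => _ [t _ <-].
move=> z; have [->|yz] := pselect (y = z).
  by rewrite (_ : _ @^-1` _ = setT)//; apply/seteqP; split.
by rewrite (_ : _ @^-1` _ = set0)//; apply/seteqP; split.
Qed.

Lemma finite_valued_ite (Y : Type) (A : set T) (s r : T -> Y) :
  measurable A -> finite_valued s -> finite_valued r ->
  finite_valued (fun t => if t \in A then s t else r t).
Proof.
move=> mA fs fr; split.
  apply: (@sub_finite_set _ _ (range s `|` range r)).
    by move=> _ [t _ <-]; case: ifP => _; [left|right]; exists t.
  by rewrite finite_setU; split; [exact: fs.1|exact: fr.1].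
move=> y; rewrite (_ : _ @^-1` _ = (A `&` s @^-1` [set y]) `|` (~` A `&` r @^-1` [set y])).
  by apply: measurableU; apply: measurableI => //; [exact: fs.2|exact: measurableC|exact: fr.2].
apply/seteqP; split => t /=.
  by case: ifPn; rewrite ?inE ?notin_setE => At <-; [left|right].
by move=> [[At <-]|[At <-]]; [rewrite mem_set|rewrite memNset].
Qed.

Lemma measurable_finite_valued d' (Y : measurableType d') (s : T -> Y) :
  finite_valued s -> measurable_fun setT s.
Proof. by move=> fs _ B _; rewrite setTI; exact: finite_valued_preimage. Qed.

Lemma finite_valued_bounded {R : realType} (X : normedModType (Cplx R)) (s : T -> X) :
  finite_valued s -> exists2 M : R, 0 < M & forall t, rnorm (s t) <= M.
Proof.
move=> [fs _].
exists (1 + \sum_(x \in range s) rnorm x).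
  by rewrite ltr_pwDl// fsumr_ge0// => i _; exact: rnorm_nonneg.
move=> t; rewrite (fsbigD1 (s t))//=; last by exists t.
by rewrite addrCA lerDl addr_ge0// fsumr_ge0// => i _; exact: rnorm_nonneg.
Qed.

End finite_valued.

(** * Linearity and norm bounds for integrals of simple functions *)

Section simple_integral.
Context (R : realType) (X : completeNormedModType (Cplx R)).
Context d (T : measurableType d) (P : probability T R).
Local Notation w r i := (fine (P (r @^-1` [set i]))).

(** The fibre of [phi \o r] over [x] is the disjoint union of the fibres of [r] over the [i] with
    [phi i = x]. *)
Lemma weight_comp (I J : choiceType) (r : T -> I) (phi : I -> J) (x : J) :
  finite_valued r ->
  w (phi \o r) x = \sum_(i \in range r) (if phi i == x then w r i else 0).
Proof.
move=> fr.
have -> : (phi \o r) @^-1` [set x] =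
    \big[setU/set0]_(i \in range r `&` phi @^-1` [set x]) (r @^-1` [set i]).
  rewrite fsbig_setU; last by apply: sub_finite_set fr.1 => ? [].
  apply/seteqP; split => t /=; first by move=> rt; exists (r t) => //; split => //; exists t.
  by move=> [i [_ <-] ->].
rewrite measure_fsbig; last 3 first.
- by apply: sub_finite_set fr.1 => ? [].
- by move=> i _; exact: fr.2.
- by move=> i j _ _ [t [/= -> ->]].
rewrite fine_fsum; last 2 first.
- by apply: sub_finite_set fr.1 => ? [].
- by move=> i _; apply: fin_num_measure; exact: fr.2.
rewrite fsbig_mkcondr; apply: eq_fsbigr => i _.
rewrite (_ : (i \in phi @^-1` [set x]) = (phi i == x))//.
by apply/idP/idP; rewrite inE/= => /eqP.
Qed.

(** Grouping the fibres of [r] by the value of [phi] does not change the sum. When [r] is a pair of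
    simple functions, both of them and their sum are integrated over one common partition, which
    gives additivity. *)
Lemma simple_integral_comp (I : choiceType) (r : T -> I) (phi : I -> X) :
  finite_valued r ->
  simple_integral P (phi \o r) = \sum_(i \in range r) ((w r i)%:C)%C *: phi i.
Proof.
move=> fr; have fr' := finite_valued_comp phi fr.
transitivity (\sum_(x \in range (phi \o r)) \sum_(i \in range r)
    (if phi i == x then ((w r i)%:C)%C *: phi i else 0)).
  apply: eq_fsbigr => x _; rewrite weight_comp// !fsbig_finite ?fr.1//= ?rmorph_sum /= ?scaler_suml; try exact: fr.1.
  by apply: eq_bigr => i _; case: eqP => [->|_]//; rewrite rmorph0 scale0r.
rewrite exchange_fsbig; [|exact: fr'.1|exact: fr.1].
apply: eq_fsbigr => i; rewrite inE => -[t _ <-].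
rewrite (fsbigD1 (phi (r t))) /=; [|exact: fr'.1|by exists t].
by rewrite eqxx fsbig1 ?addr0// => x [_ /= /eqP]; rewrite eq_sym => /negbTE ->.
Qed.

Lemma simple_integralD (s r : T -> X) : simple_fun s -> simple_fun r ->
  simple_integral P (s \+ r) = simple_integral P s + simple_integral P r.
Proof.
move=> fs fr; have fsr := finite_valued_pair fs fr.
pose p t := (s t, r t).
rewrite [LHS](simple_integral_comp (r := p) (fun p => p.1 + p.2))//.
rewrite [X in X + _](simple_integral_comp (r := p) fst)//.
rewrite [X in _ + X](simple_integral_comp (r := p) snd)//.
rewrite -fsbig_split/=; last exact: fsr.1.
by apply: eq_fsbigr => i _; rewrite scalerDr.
Qed.

Lemma simple_integralZ (a : Cplx R) (s : T -> X) : simple_fun s ->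
  simple_integral P (fun t => a *: s t) = a *: simple_integral P s.
Proof.
move=> fs; rewrite [LHS](simple_integral_comp (r := s) (fun x => a *: x))//.
rewrite /simple_integral !fsbig_finite; try exact: fs.1.
by rewrite scaler_sumr; apply: eq_bigr => i _; rewrite !scalerA mulrC.
Qed.

Lemma simple_integralB (s r : T -> X) : simple_fun s -> simple_fun r ->
  simple_integral P (fun t => s t - r t) = simple_integral P s - simple_integral P r.
Proof.
move=> fs fr; rewrite -[- simple_integral _ r]scaleN1r -simple_integralZ//.
rewrite -simple_integralD//; last exact: (finite_valued_comp (fun x => -1 *: x)).
by congr simple_integral; apply/funext => t /=; rewrite scaleN1r.
Qed.

Lemma simple_integral_cst (x : X) : simple_integral P (fun=> x) = x.
Proof.
rewrite (simple_integral_comp (r := fun=> tt) (fun=> x)); last exact: finite_valued_cst.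
rewrite (_ : range _ = [set tt]); last first.
  by apply/seteqP; split => [[] //|[] _]; exists point.
rewrite fsbig_set1 (_ : _ @^-1` _ = setT); last by apply/seteqP; split.
by rewrite probability_setT/= scale1r.
Qed.

Lemma integral_rnorm_simple (s : T -> X) : simple_fun s ->
  (\int[P]_t (rnorm (s t))%:E)%E =
  (\sum_(x \in range s) w s x * rnorm x)%:E.
Proof.
move=> fs.
transitivity (\int[P]_t (\sum_(x \in range s)
    (rnorm x)%:E * (\1_(s @^-1` [set x]) t)%:E)%E)%E.
  apply: eq_integral => t _.
  rewrite (fsbigD1 (s t))/=; [|exact: fs.1|by exists t].
  rewrite indicE mem_set// mule1 fsbig1 ?adde0// => x [_ /= /eqP xs].
  by rewrite indicE memNset ?mule0//=; apply/eqP; rewrite eq_sym.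
rewrite ge0_integral_fsum//; last 3 first.
- move=> x; apply/measurable_EFinP/measurable_funM => //.
  by apply: measurable_indic; exact: fs.2.
- by move=> x t _; rewrite mule_ge0// lee_fin rnorm_nonneg.
- exact: fs.1.
rewrite !fsbig_finite; try exact: fs.1.
rewrite -sumEFin; apply: eq_bigr => x _.
rewrite ge0_integralZl//; last 2 first.
- by apply/measurable_EFinP/measurable_indic; exact: fs.2.
- by rewrite lee_fin rnorm_nonneg.
rewrite integral_indic ?setIT//; last exact: fs.2.
by rewrite muleC EFinM fineK// fin_num_measure//; exact: fs.2.
Qed.

Lemma rnorm_simple_integral_le (s : T -> X) : simple_fun s ->
  ((rnorm (simple_integral P s))%:E <= \int[P]_t (rnorm (s t))%:E)%E.
Proof.
move=> fs; rewrite integral_rnorm_simple// lee_fin /simple_integral.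
rewrite !fsbig_finite; try exact: fs.1.
rewrite (le_trans (rnorm_sum _ _))// ler_sum// => x _.
by rewrite rnormZ rnorm_realC// fine_ge0.
Qed.

End simple_integral.

(** * Integrals of nonnegative functions measurable off a null set *)

Section lower_integral.
Context (R : realType) d (T : measurableType d) (P : probability T R).
Local Open Scope ereal_scope.

Import HBNNSimple.

(* No measurability is assumed: the integral of a nonnegative function is the
   supremum of the integrals of the simple functions below it. *)
Lemma ge0_integral_mono (f g : T -> \bar R) :
  (forall t, 0 <= f t) -> (forall t, f t <= g t) ->
  \int[P]_t f t <= \int[P]_t g t.
Proof.
move=> f0 fg; rewrite !ge0_integralTE//; last by move=> t; exact: le_trans (fg t).
apply: ereal_sup_le => _ [h hf <-]; exists h => // t; exact: le_trans (fg t).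
Qed.

Lemma ge0_integral_mono_set (f : T -> \bar R) (D : set T) :
  (forall t, 0 <= f t) -> \int[P]_(t in D) f t <= \int[P]_t f t.
Proof.
move=> f0; rewrite integral_mkcond; apply: ge0_integral_mono => t.
  by rewrite patchE; case: ifP.
by rewrite patchE; case: ifP.
Qed.

(** This is what an almost everywhere limit of simple functions provides, as [P] is not assumed
    complete. *)
Definition ae_measurable (a : T -> R) : Prop :=
  exists2 N : set T, measurable N & P N = 0 /\ measurable_fun (~` N) a.

(** Off the two null sets everything is measurable and the integral is additive. Removing them does
    not change the integral of [h], and putting them back can only enlarge the right-hand side. *)
Lemma integral_le_add (h a b : T -> R) (c : R) :
  measurable_fun setT h -> ae_measurable a -> ae_measurable b ->
  (forall t, 0 <= h t)%R -> (forall t, 0 <= a t)%R -> (forall t, 0 <= b t)%R ->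
  (0 <= c)%R -> (forall t, h t <= a t + b t + c)%R ->
  \int[P]_t (h t)%:E <= \int[P]_t (a t)%:E + \int[P]_t (b t)%:E + c%:E.
Proof.
move=> mh [N mN [N0 ma]] [N' mN' [N'0 mb]] h0 a0 b0 c0 habc.
have mNN : measurable (N `|` N') by exact: measurableU.
have NN0 : P (N `|` N') = 0 by rewrite measureU0.
have mD : measurable (~` (N `|` N')) by exact: measurableC.
have mha : measurable_fun (~` (N `|` N')) (EFin \o a).
  by apply/measurable_EFinP; apply: measurable_funS ma; [exact: measurableC|move=> t /not_orP[]].
have mhb : measurable_fun (~` (N `|` N')) (EFin \o b).
  by apply/measurable_EFinP; apply: measurable_funS mb; [exact: measurableC|move=> t /not_orP[]].
rewrite (ge0_negligible_integral mNN)//; last 2 first.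
- exact/measurable_EFinP.
- by move=> t _; rewrite lee_fin.
rewrite setTD.
apply: (@le_trans _ _ (\int[P]_(t in ~` (N `|` N')) ((a t)%:E + (b t)%:E + c%:E))).
  apply: ge0_le_integral => //.
  - by move=> t _; rewrite lee_fin.
  - by apply/measurable_EFinP; exact: measurable_funS mh.
  - by apply: emeasurable_funD => //; apply: emeasurable_funD.
  - by move=> t _; rewrite -!EFinD lee_fin.
rewrite ge0_integralD; [|exact: mD|move=> t _| |by move=> t _; rewrite lee_fin|by []]; last 2 first.
- by rewrite -EFinD lee_fin addr_ge0.
- exact: emeasurable_funD.
rewrite ge0_integralD//; last 2 first.
- by move=> t _; rewrite lee_fin.
- by move=> t _; rewrite lee_fin.
apply: leeD; first apply: leeD.
- by apply: ge0_integral_mono_set => t; rewrite lee_fin.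
- by apply: ge0_integral_mono_set => t; rewrite lee_fin.
- rewrite integral_cst// -[leRHS]mule1; apply: lee_wpmul2l; first by rewrite lee_fin.
  exact: probability_le1.
Qed.

End lower_integral.

(** * Bochner integrals and uniform approximation *)

Section bochner_theory.
Context (R : realType) (X : completeNormedModType (Cplx R)).
Context d (T : measurableType d) (P : probability T R).
Implicit Types (f F : T -> X) (v : X).

Lemma has_bochner_integral_strongly_measurable f v :
  has_bochner_integral P f v -> strongly_measurable P f.
Proof. by move=> [s_ [? ? _ _]]; exists s_. Qed.

Lemma ae_measurable_rnormB f (u : T -> X) : strongly_measurable P f ->
  simple_fun u -> ae_measurable P (fun t => rnorm (f t - u t)).
Proof.
move=> [s_ [fs [N [mN N0 HN]]]] fu; exists N => //; split => //.
apply: (@measurable_fun_cvg _ _ _ _ (fun n t => rnorm (s_ n t - u t))).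
  move=> n; apply: measurable_funTS; apply: measurable_finite_valued.
  exact: (finite_valued_comp (fun p => rnorm (p.1 - p.2)) (finite_valued_pair (fs n) fu)).
move=> t Nt; apply: cvg_rnorm; apply: cvgB; last exact: cvg_cst.
by apply: contrapT => ?; exact/Nt/HN.
Qed.

(** For a late term [s_ n] of a sequence defining [v], the norm of [s_ n - u] is at most that of
    [f - s_ n] plus [b + c], and the norm of [f - s_ n] has a small integral. *)
Lemma bochner_integral_estimate f v (u : T -> X) (b : T -> R) (c : R) :
  has_bochner_integral P f v -> simple_fun u -> ae_measurable P b ->
  (forall t, 0 <= b t) -> 0 <= c ->
  (forall t, rnorm (f t - u t) <= b t + c) ->
  ((rnorm (v - simple_integral P u))%:E <= \int[P]_t (b t)%:E + c%:E)%E.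
Proof.
move=> fv fu mb b0 c0 fub.
have mf := has_bochner_integral_strongly_measurable fv.
have [s_ [fs _ s_f s_v]] := fv.
apply/lee_addgt0Pr => e e0; have e20 : 0 < e / 2 by rewrite divr_gt0.
have [n []] : exists n, rnorm (simple_integral P (s_ n) - v) < e / 2 /\
    (\int[P]_t (rnorm (f t - s_ n t))%:E < (e / 2)%:E)%E.
  near \oo => n; exists n; split.
    by near: n; move/cvg_rnormP : s_v; exact.
  near: n; apply: (s_f [set x | (x < (e / 2)%:E)%E]); apply: open_nbhs_nbhs.
  by split; [exact: open_ereal_lt_ereal|rewrite /= lte_fin].
move=> nv nf; have := integral_le_add (h := fun t => rnorm (s_ n t - u t))
  (measurable_finite_valued (finite_valued_comp (fun p => rnorm (p.1 - p.2))
     (finite_valued_pair (fs n) fu))) (ae_measurable_rnormB mf (fs n)) mb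
  (fun=> rnorm_nonneg _) (fun=> rnorm_nonneg _) b0 c0.
have fsu : simple_fun (fun t => s_ n t - u t).
  exact: (finite_valued_comp (fun p => p.1 - p.2) (finite_valued_pair (fs n) fu)).
have /= := rnorm_simple_integral_le P fsu; rewrite simple_integralB// => H1 H2.
have {}H2 := le_trans H1 (H2 _).
apply: (@le_trans _ _ ((e / 2)%:E + ((e / 2)%:E + \int[P]_t (b t)%:E + c%:E))%E).
  apply: (@le_trans _ _ ((e / 2)%:E +
      (rnorm (simple_integral P (s_ n) - simple_integral P u))%:E)%E).
    rewrite -EFinD lee_fin (le_trans (rnorm_dist_triangle (simple_integral P (s_ n)) _ _))//.
    by rewrite lerD2r ltW// rnorm_distC.
  rewrite leeD2l// (le_trans (H2 _))//.
    move=> t; rewrite -addrA (le_trans (rnorm_dist_triangle (f t) _ _))//.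
    by rewrite lerD ?fub// rnorm_distC.
  by rewrite leeD2r// leeD2r// ltW.
by rewrite [leRHS]addeC [X in (_ <= X%:E + _)%E](splitr e) EFinD -!addeA.
Unshelve. all: by end_near. Qed.

(** Stronger than Bochner integrability, this notion passes to sums and uniform limits without any
    almost everywhere argument. It suffices for continuous functions on a compact group. *)
Definition uniform_integral F v : Prop := forall e : R, 0 < e ->
  exists s, [/\ simple_fun s, forall t, rnorm (F t - s t) <= e &
    rnorm (simple_integral P s - v) <= e].

Lemma uniform_integral_has_bochner_integral F v :
  uniform_integral F v -> has_bochner_integral P F v.
Proof.
move=> Fv; have /choice[s_ Hs] : forall n : nat, exists s,
    [/\ simple_fun s, forall t, rnorm (F t - s t) <= n.+1%:R^-1 &
    rnorm (simple_integral P s - v) <= n.+1%:R^-1].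
  by move=> n; apply: Fv; rewrite invr_gt0.
have lim_inv (e : R) : 0 < e -> \forall n \near \oo, n.+1%:R^-1 < e.
  by move=> e0; apply: (cvgr_lt _ (cvg_harmonic)).
exists s_; split.
- by move=> n; have [] := Hs n.
- apply: aeW => t; apply/cvg_rnormP => e /lim_inv; apply: filterS => n.
  by apply: le_lt_trans; rewrite rnorm_distC; case: (Hs n) => _ + _; exact.
- apply: (@squeeze_cvge _ _ _ _ (cst 0%E) _ (fun n => (n.+1%:R^-1)%:E)).
  + apply: nearW => n; rewrite integral_ge0//=; last by move=> t _; rewrite lee_fin rnorm_nonneg.
    apply: (@le_trans _ _ (\int[P]_t (n.+1%:R^-1)%:E)%E).
      by apply: ge0_integral_mono => t; rewrite lee_fin ?rnorm_nonneg//; case: (Hs n) => _ + _; exact.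
    rewrite integral_cst// -[leRHS]mule1; apply: lee_wpmul2l; first by rewrite lee_fin.
    exact: probability_le1.
  + exact: cvg_cst.
  + by apply: cvg_EFin; [exact: nearW|exact: cvg_harmonic].
- apply/cvg_rnormP => e /lim_inv; apply: filterS => n.
  by apply: le_lt_trans; case: (Hs n).
Qed.

(** A simple function within [e / 2] of [F] can be chosen with its integral within [e / 2] of [v];
    by [bochner_integral_estimate] with zero [b], that integral is also within [e / 2] of [w]. *)
Lemma has_bochner_integral_unique F v w :
  uniform_integral F v -> has_bochner_integral P F w -> w = v.
Proof.
move=> Fv Fw; apply/eqP; rewrite -subr_eq0; apply/eqP/rnorm_eq0/le_anti.
rewrite rnorm_nonneg andbT; apply/ler_addgt0Pr => e e0; rewrite add0r.
have [s [fs Fs sv]] := Fv _ (divr_gt0 e0 (ltr0n R 2)).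
have m0 : ae_measurable P (cst (0 : R)) by exists set0.
have := bochner_integral_estimate Fw fs m0 (fun=> lexx _) (ltW (divr_gt0 e0 (ltr0n R 2))).
rewrite integral0 add0e lee_fin => /(_ _)/= H.
rewrite (le_trans (rnorm_dist_triangle (simple_integral P s) _ _))// [leRHS]splitr lerD// H//.
by move=> t; rewrite add0r.
Qed.

Lemma bochner_integralE F v : uniform_integral F v -> bochner_integral P F = v.
Proof.
move=> Fv; apply: xget_unique; first exact: uniform_integral_has_bochner_integral.
by move=> w; exact: has_bochner_integral_unique.
Qed.

(** The default value of [bochner_integral] is [0], so any other value is a genuine integral. This
    recovers integrability from a nonzero Fourier coefficient. *)
Lemma bochner_integral_neq0 F : bochner_integral P F != 0 ->
  has_bochner_integral P F (bochner_integral P F).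
Proof.
by rewrite /bochner_integral; case: xgetP => [v -> //|]; rewrite eqxx.
Qed.

Lemma uniform_integralD F v F' v' : uniform_integral F v ->
  uniform_integral F' v' -> uniform_integral (F \+ F') (v + v').
Proof.
move=> Fv Fv' e e0; have e20 := divr_gt0 e0 (ltr0n R 2).
have [s [fs Fs sv]] := Fv _ e20; have [r [fr Fr rv]] := Fv' _ e20.
exists (s \+ r); split.
- exact: (finite_valued_comp (fun p => p.1 + p.2) (finite_valued_pair fs fr)).
- move=> t /=; rewrite opprD addrACA (le_trans (rnorm_triangle _ _))//.
  by rewrite [leRHS]splitr lerD.
- rewrite simple_integralD// opprD addrACA (le_trans (rnorm_triangle _ _))//.
  by rewrite [leRHS]splitr lerD.
Qed.

Lemma uniform_integral_cst v : uniform_integral (fun=> v) v.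
Proof.
move=> e e0; exists (fun=> v); split; first exact: finite_valued_cst.
  by move=> t; rewrite subrr rnorm_zero ltW.
by rewrite simple_integral_cst subrr rnorm_zero ltW.
Qed.

Lemma uniform_integral_sum (I : Type) (r : seq I) (F : I -> T -> X) (v : I -> X) :
  (forall i, uniform_integral (F i) (v i)) ->
  uniform_integral (fun t => \sum_(i <- r) F i t) (\sum_(i <- r) v i).
Proof.
move=> Fv; elim: r => [|i r IH].
  under eq_fun do rewrite big_nil; rewrite big_nil; exact: uniform_integral_cst.
under eq_fun do rewrite big_cons; rewrite big_cons.
exact: (uniform_integralD (Fv i)).
Qed.

Lemma uniform_integral_limit F v :
  (forall e : R, 0 < e -> exists F' v', [/\ uniform_integral F' v',
     forall t, rnorm (F t - F' t) <= e & rnorm (v' - v) <= e]) ->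
  uniform_integral F v.
Proof.
move=> H e e0; have e20 := divr_gt0 e0 (ltr0n R 2).
have [F' [v' [/(_ _ e20)[s [fs F's sv']] FF' v'v]]] := H _ e20.
exists s; split=> [//|t|].
  by rewrite (le_trans (rnorm_dist_triangle (F' t) _ _))// [leRHS]splitr lerD ?FF' ?F's.
by rewrite (le_trans (rnorm_dist_triangle v' _ _))// [leRHS]splitr lerD.
Qed.

End bochner_theory.

Section simple_integral_bound.
Context (R : realType) (X : completeNormedModType (Cplx R)).
Context d (T : measurableType d) (P : probability T R).

Lemma rnorm_simple_integral_le_indic (u : T -> X) (B : set T) (c K : R) :
  simple_fun u -> measurable B -> 0 <= c -> 0 <= K ->
  (forall t, rnorm (u t) <= c + K * \1_B t) ->
  rnorm (simple_integral P u) <= c + K * fine (P B).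
Proof.
move=> fu mB c0 K0 ucK; rewrite -lee_fin (le_trans (rnorm_simple_integral_le _ fu))//.
apply: (@le_trans _ _ (\int[P]_t (c%:E + K%:E * (\1_B t)%:E))%E).
  by apply: ge0_integral_mono => t; rewrite lee_fin ?rnorm_nonneg.
have mK : measurable_fun setT (fun t => (K%:E * (\1_B t)%:E)%E).
  by apply/measurable_EFinP/measurable_funM => //; exact: measurable_indic.
rewrite ge0_integralD//; last by move=> t _; rewrite mule_ge0// lee_fin.
rewrite ge0_integralZl//; last by apply/measurable_EFinP; exact: measurable_indic.
rewrite integral_indic// setIT EFinD EFinM fineK ?fin_num_measure//.
rewrite leeD2r// integral_cst// -[leRHS]mule1; apply: lee_wpmul2l; first by rewrite lee_fin.
exact: probability_le1.
Qed.

Lemma rnorm_simple_integral_le_cst (u : T -> X) (c : R) :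
  simple_fun u -> (forall t, rnorm (u t) <= c) ->
  rnorm (simple_integral P u) <= c.
Proof.
move=> fu uc; have c0 : 0 <= c by rewrite (le_trans (rnorm_nonneg (u point))).
rewrite -[c]addr0 -(mul0r (fine (P set0))).
apply: rnorm_simple_integral_le_indic => // t.
by rewrite mul0r addr0.
Qed.

End simple_integral_bound.

(** * Uniform approximation of continuous functions on a compact group *)

Section compact_approximation.
Context (R : realType) (G : topologicalZmodType).

Lemma open_borel_measurable (A : set G) : open A -> measurable (A : set (borel G)).
Proof. exact: sub_sigma_algebra. Qed.

(** Finitely many of the open sets [U y], on which [phi] is within [e] of [phi y], cover the group;
    [q t] is the value of [phi] at the centre of the first listed set containing [t]. *)
Lemma continuous_finite_valued_approx (V : normedModType (Cplx R)) (phi : G -> V)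
    (e : R) : compact [set: G] -> continuous phi -> 0 < e ->
  exists q : borel G -> V,
    finite_valued q /\ forall t : G, rnorm (phi t - q t) <= e.
Proof.
move=> cG cphi e0.
pose U (y : G) : set G := [set t | rnorm (phi t - phi y) < e].
have oU y : open (U y).
  apply: (@open_comp _ _ (fun t => rnorm (phi t - phi y)) [set r | r < e]) => [t _|].
    by apply: cvg_rnorm; apply: cvgB; [exact: cphi|exact: cvg_cst].
  exact: open_lt.
have : @cover_compact (pointed_at0 G) setT by rewrite -compact_cover.
move=> /(_ G setT U) [//|t _|D _ cover].
  by exists t => //; rewrite /U /= subrr rnorm_zero.
have {cover} : forall t, exists2 y, y \in finmap.enum_fset D & U y t.
  by move=> t; have [y ? ?] := cover t Logic.I; exists y.
(* The bound is claimed only on the sets already listed, so the induction can start from the empty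
   list. *)
suff [q [fq Hq]] : exists q : borel G -> V, finite_valued q /\
    forall t y, y \in finmap.enum_fset D -> U y t -> rnorm (phi t - q t) <= e.
  by move=> H; exists q; split => // t; have [y] := H t; exact: Hq.
elim: (finmap.enum_fset D) => [|y l [q [fq Hq]]].
  by exists (fun=> 0); split => //; exact: finite_valued_cst.
exists (fun t => if t \in U y then phi y else q t); split.
  by apply: finite_valued_ite => //; [exact: open_borel_measurable|exact: finite_valued_cst].
move=> t z; rewrite inE; case: ifPn => [/set_mem/= yt _ _|/negP yt]; first exact: ltW.
by move=> /orP[/eqP -> /mem_set|] //; exact: Hq.
Qed.

End compact_approximation.

(** * Haar measure and translations *)

Section haar_translation.
Context (R : realType) (G : topologicalZmodType) (m : probability (borel G) R).
Hypothesis m_haar : is_haar m.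
Hypothesis cG : compact [set: G].

Lemma continuous_translate (y : G) : continuous (fun t : G => y + t).
Proof.
move=> t; apply: (@continuous_comp _ _ _ (fun x => (y, x)) (fun p : G * G => p.1 + p.2)).
  by apply: cvg_pair; [exact: cvg_cst|exact: cvg_id].
exact: tvs.add_continuous.
Qed.

Lemma measurable_translate (y : G) (A : set (borel G)) : measurable A ->
  measurable ([set t : G | A (y + t)] : set (borel G)).
Proof.
move=> mA; rewrite -[X in measurable X]setTI.
have : measurable_fun setT (fun t : borel G => (y + (t : G) : borel G)).
  apply: (@measurability _ _ (borel G) (borel G) setT (fun t : G => y + t) (@open (pointed_at0 G))) => //.
  move=> _ [U oU <-]; rewrite setTI; apply: open_borel_measurable.
  by apply: open_comp => // t _; exact: continuous_translate.
by apply.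
Qed.

Lemma finite_valued_translate (Y : Type) (s : borel G -> Y) (y : G) :
  finite_valued s -> finite_valued ((fun t : G => s (y + t)) : borel G -> Y).
Proof.
move=> fs; split; last by move=> x; exact: measurable_translate (fs.2 x).
by apply: sub_finite_set fs.1 => _ [t _ <-]; exists (y + (t : G)).
Qed.

Lemma simple_integral_translate (X : completeNormedModType (Cplx R))
    (s : borel G -> X) (y : G) : simple_fun s ->
  simple_integral m ((fun t : G => s (y + t)) : borel G -> X) = simple_integral m s.
Proof.
move=> fs; rewrite /simple_integral.
have -> : range (fun t : G => s (y + t)) = range s.
  apply/seteqP; split => _ [t _ <-]; first by exists (y + (t : G)).
  by exists ((t : G) - y) => //; rewrite addrC subrK.
by apply: eq_fsbigr => x _; rewrite -(m_haar.1 y _ (fs.2 x)).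
Qed.

(* Translating by [y] multiplies the integral of [chi *: x] by [chi y]. *)
Lemma uniform_integral_character_eq0 (X : completeNormedModType (Cplx R))
    (chi : G -> Cplx R) (y : G) (x : X) :
  is_character chi -> chi y != 1 ->
  uniform_integral m (fun t => chi t *: x) 0.
Proof.
move=> [cchi chiD chi1] chiy e e0.
pose k := rnorm (1 - chi y : (Cplx R)^o).
have k0 : 0 < k.
  rewrite lt_def rnorm_nonneg andbT; apply/eqP => /rnorm_eq0 /eqP.
  by rewrite subr_eq0 eq_sym; exact/negP.
(* The integral of [u] below is [1 - chi y] times that of [q] and has norm at most [2 e']; dividing
   by [k] leaves at most [e]. *)
pose e' := Num.min e (e * k / 2).
have e'0 : 0 < e' by rewrite /e' lt_min e0 divr_gt0// mulr_gt0.
have cphi : continuous (fun t => chi t *: x).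
  by move=> t; apply: cvgZr_tmp; exact: cchi.
have [q [fq Hq]] := continuous_finite_valued_approx cG cphi e'0.
exists q; split => //.
  by move=> t; rewrite (le_trans (Hq t))// /e' ge_min lexx.
rewrite subr0.
pose u : borel G -> X := fun t => q (y + (t : G)) - chi y *: q t.
have fqy := finite_valued_translate y fq.
have fcq : simple_fun (fun t => chi y *: q t) by exact: (finite_valued_comp (fun z => chi y *: z) fq).
have fu : simple_fun u.
  exact: (finite_valued_comp (fun p => p.1 - p.2) (finite_valued_pair fqy fcq)).
have : rnorm (simple_integral m u) <= e' + e'.
  apply: rnorm_simple_integral_le_cst => // t.
  rewrite (le_trans (rnorm_dist_triangle (chi (y + (t : G)) *: x) _ _))// lerD//.
    by rewrite rnorm_distC; exact: Hq.
  rewrite chiD -scalerA -scalerBr rnormZ /rnorm chi1/= mul1r; exact: Hq.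
rewrite simple_integralB// simple_integral_translate// simple_integralZ//.
rewrite -[X in X - _]scale1r -scalerBl rnormZ -/k => H.
rewrite -(ler_pM2l k0) (le_trans H)// (@le_trans _ _ (e * k / 2 + e * k / 2))//.
  by rewrite lerD// /e' ge_min lexx orbT.
by rewrite -splitr mulrC.
Qed.

(** The outer regularity contained in [is_haar], in a form to be applied to a set and to its
    complement. *)
Lemma borel_open_approx (A : set (borel G)) (e : R) : measurable A -> 0 < e ->
  exists U : set G, [/\ open U, A `<=` U & (m (U `\` A) <= e%:E)%E].
Proof.
move=> mA e0.
have fA : m A \is a fin_num by exact: fin_num_measure.
have := m_haar.2 A mA => mAE.
have [|_ [U [oU AU] <-]] := @lb_ereal_inf_adherent _ _ e e0 (_ : ereal_inf
  [set m U | U in [set U : set G | open U /\ A `<=` U]] \is a fin_num).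
  by rewrite -mAE.
rewrite -mAE => UA; exists U; split => //.
have mU := open_borel_measurable oU.
rewrite measureD//; last by rewrite ltey_eq fin_num_measure.
rewrite setIidr// leeBlDr//.
by rewrite addeC ltW.
Qed.

(* [A] lies between a compact and an open set of almost the same measure. *)
Lemma near0_translate_measure (A : set (borel G)) (e : R) : measurable A -> 0 < e ->
  \forall y \near (0 : G),
    (m ([set t : G | A t /\ ~ A (y + t)%R] : set (borel G)) <= e%:E)%E.
Proof.
move=> mA e0; have e20 : 0 < e / 2 by rewrite divr_gt0.
have [U [oU AU mUA]] := borel_open_approx mA e20.
have [V [oV AV mVA]] := borel_open_approx (measurableC mA) e20.
have cK : compact (~` V).
  by apply: subclosed_compact cG _ => //; exact: open_closedC.
(* The complement of [V] is a compact subset of [A], hence of the open set [U]; its translates by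
   all [y] near [0] then stay in [U]. *)
have /compact_near_coveringP/(_ G (nbhs (0 : G)) (fun y t => U (y + t))) := cK.
move=> /(_ _ _) H.
have {H} : \forall y \near (0 : G), ~` V `<=` (fun t => U (y + t)).
  apply: H => t Vt.
  have Ut : U (0 + t) by rewrite add0r; apply: AU; apply: contrapT => At; exact/Vt/AV.
  have := @tvs.add_continuous G (t, 0) U; rewrite /= addrC => /(_ _) H.
  have {}H := H (open_nbhs_nbhs (conj oU Ut)).
  apply: (@filterS _ (filter_prod (nbhs t) (nbhs (0 : G))) _ _ _ _ H) => p.
  by rewrite /= addrC.
apply: filterS => y KU.
have mUy := measurable_translate y (measurableD (open_borel_measurable oU) mA).
have mVA' := measurableD (open_borel_measurable oV) (measurableC mA).
(* A point of [A] that leaves [A] either lies in [V], or its translate lies in [U] outside [A]. Both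
   sets have measure at most [e / 2], the second by invariance. *)
apply: (@le_trans _ _ (m ((V `\` ~` A) `|` ([set t : G | (U `\` A) (y + t)%R] : set (borel G))))%E).
  apply: le_measure.
  - rewrite inE; apply: measurableI => //; apply: measurableC; exact: measurable_translate.
  - by rewrite inE; exact: measurableU.
  - move=> t [At nAt]; have [Vt|/KU Ut] := pselect (V t); [left|right] => //.
    by split => //; exact.
rewrite (le_trans (measureU2 _ _ _))// [e in leRHS]splitr EFinD leeD//.
have mT := m_haar.1 y _ (measurableD (open_borel_measurable oU) mA).
by apply: le_trans mUA; rewrite le_eqVlt; apply/orP; left; exact/eqP.
Qed.

(** Where [s] changes under translation, the point leaves the fibre of its value. The estimate for
    one set is applied to each of the finitely many fibres, halving the error each time.
    [{classic Y}] provides decidable membership in the list of values. *)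
Lemma near0_translate_finite_valued (Y : Type) (s : borel G -> Y) (e : R) :
  finite_valued s -> 0 < e ->
  \forall y \near (0 : G),
    (m ([set t : G | s (y + t)%R <> s t] : set (borel G)) <= e%:E)%E.
Proof.
move=> fs e0.
have [l Hl] : exists l : seq {classic Y}, forall t, (s t : {classic Y}) \in l.
  have /finite_seqP[l Hl] := fs.1 : finite_set (range (s : borel G -> {classic Y})).
  by exists l => t; have : [set` l] (s t) by rewrite -Hl; exists t.
have H e' (k : seq {classic Y}) : 0 < e' -> \forall y \near (0 : G),
    (m ([set t : G | (s t : {classic Y}) \in k /\ s (y + t)%R <> s t] : set (borel G)) <= e'%:E)%E.
  elim: k e' => [|x k IH] e' e'0.
    near=> y; rewrite (_ : [set t | _] = set0) ?measure0 ?lee_fin ?ltW//.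
    by apply/seteqP; split => t //= [].
  have e'20 : 0 < e' / 2 by rewrite divr_gt0.
  apply: filterS2 (near0_translate_measure (fs.2 x) e'20) (IH _ e'20) => y mx mk.
  have mfx := finite_valued_pair fs (finite_valued_translate y fs).
  have mS (Q : Y -> Y -> Prop) : measurable ([set t : G | Q (s t) (s (y + t))] : set (borel G)).
    exact: (finite_valued_preimage (fun p => Q p.1 p.2) mfx).
  apply: (@le_trans _ _ (m (([set t : G | s t = x /\ ~ s (y + t)%R = x] : set (borel G)) `|`
    [set t : G | (s t : {classic Y}) \in k /\ s (y + t)%R <> s t])%E)).
    apply: le_measure; rewrite ?inE.
    - exact: (mS (fun a b => (a : {classic Y}) \in x :: k /\ b <> a)).
    - apply: measurableU; first exact: (mS (fun a b => a = x /\ ~ b = x)).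
      exact: (mS (fun a b => (a : {classic Y}) \in k /\ b <> a)).
    - move=> t /= []; rewrite inE => /orP[/eqP tx|tk] yt; [left|by right].
      by split => // yx; apply: yt; rewrite yx.
  rewrite (le_trans (measureU2 _ _ _))//.
  - exact: (mS (fun a b => a = x /\ ~ b = x)).
  - exact: (mS (fun a b => (a : {classic Y}) \in k /\ b <> a)).
  - by rewrite [e' in leRHS]splitr EFinD leeD.
apply: filterS (H e l e0) => y; rewrite (_ : [set t | s (y + t) <> s t] =
  [set t : G | (s t : {classic Y}) \in l /\ s (y + t) <> s t])//.
by apply/seteqP; split => t //= [].
Unshelve. all: by end_near. Qed.

End haar_translation.

(** * Characters of the group *)

Section characters.
Context (R : realType) (G : topologicalZmodType).
Local Notation C := (Cplx R).
Implicit Types gamma chi : G -> C.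

Lemma rnorm_character gamma t : is_character gamma -> rnorm (gamma t : C^o) = 1.
Proof. by move=> [_ _ g1]; rewrite /rnorm g1. Qed.

Lemma rnorm_conjC (z : C) : rnorm (z^* : C^o) = rnorm (z : C^o).
Proof. by rewrite /rnorm norm_conjC. Qed.

Lemma character_mul_conj gamma t : is_character gamma -> (gamma t)^* * gamma t = 1.
Proof. by move=> [_ _ g1]; rewrite mulrC -normCK g1 expr1n. Qed.

Lemma is_character_conj_mul gamma chi : is_character gamma -> is_character chi ->
  is_character (fun t => (gamma t)^* * chi t).
Proof.
move=> [cg gD g1] [cc cD c1]; split.
- move=> t; apply: cvgM; last exact: cc.
  apply/(@cvg_rnormP R C^o) => e e0.
  have /(@cvg_rnormP R C^o)/(_ e e0) := cg t.
  by apply: filterS => z; rewrite -rmorphB /= rnorm_conjC.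
- by move=> x y; rewrite gD cD rmorphM/= mulrACA.
- by move=> x; rewrite normrM norm_conjC g1 c1 mulr1.
Qed.

Lemma is_character_cst1 : is_character (fun _ : G => 1 : C).
Proof.
split => [t|x y|x]; [exact: cvg_cst|by rewrite mulr1|exact: normr1].
Qed.

End characters.

(** * A Riemann-Lebesgue estimate *)

Section riemann_lebesgue.
Context (R : realType) (G : topologicalZmodType) (m : probability (borel G) R).
Hypothesis m_haar : is_haar m.
Hypothesis cG : compact [set: G].
Context (X : completeNormedModType (Cplx R)).
Local Notation C := (Cplx R).

(* If [chi y = -1], translation by [y] nearly changes the sign of [chi *: g],
   since [g] is nearly invariant in mean: its integral must be small. *)
Lemma near0_bochner_integral_character (g : borel G -> X) (w : X) (e : R) :
  has_bochner_integral m g w -> 0 < e ->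
  \forall y \near (0 : G), forall (chi : G -> C) (v : X), is_character chi ->
    chi y = -1 -> has_bochner_integral m (fun t => chi t *: g t) v ->
    rnorm v <= e.
Proof.
move=> gw e0; have e40 : 0 < e / 4 by rewrite divr_gt0.
have [s [fs sg]] : exists s : borel G -> X, simple_fun s /\
    (\int[m]_t (rnorm (g t - s t))%:E < (e / 4)%:E)%E.
  have [s_ [fs _ s_g _]] := gw.
  suff [n ns] : exists n, (\int[m]_t (rnorm (g t - s_ n t))%:E < (e / 4)%:E)%E.
    by exists (s_ n).
  near \oo => n; exists n; near: n.
  apply: (s_g [set x | (x < (e / 4)%:E)%E]); apply: open_nbhs_nbhs.
  by split; [exact: open_ereal_lt_ereal|rewrite /= lte_fin].
have [M M0 sM] := finite_valued_bounded fs.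
(* Chosen so that [2 * M] times this measure is [e / 4]. *)
have eta0 : 0 < e / (8 * M) by rewrite divr_gt0// mulr_gt0.
apply: filterS (near0_translate_finite_valued m_haar cG fs eta0) => y my chi v chiC chiy chiv.
have [cchi chiD chi1] := chiC.
(* The bound [1] keeps the approximation [q] of [chi] below [2] in norm; the other one makes the
   error of replacing [chi] by [q] in [chi *: s] at most [e / 4]. *)
pose dl := Num.min 1 (e / (4 * M)).
have dl0 : 0 < dl by rewrite lt_min ltr01 divr_gt0// mulr_gt0.
have dl1 : dl <= 1 by rewrite ge_min lexx.
have dlM : dl * M <= e / 4.
  rewrite (@le_trans _ _ (e / (4 * M) * M))//; first by rewrite ler_wpM2r ?(ltW M0)// /dl ge_min lexx orbT.
  by rewrite invfM mulrA mulfVK// gt_eqF.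
have [q [fq Hq]] := @continuous_finite_valued_approx R G C^o chi dl cG cchi dl0.
pose u : borel G -> X := fun t => (q t : C) *: s t.
have fu : simple_fun u.
  exact: (finite_valued_comp (fun p => (p.1 : C) *: p.2) (finite_valued_pair fq fs)).
have q2 t : rnorm (q t : C^o) <= 2.
  rewrite -[q t](subrK (chi t : C^o)) (le_trans (rnorm_triangle _ _))//.
  rewrite rnorm_character// lerD2r rnorm_distC.
  exact: le_trans (Hq t) dl1.
have uv : rnorm (v - simple_integral m u) <= e / 4 + e / 4.
  rewrite -lee_fin.
  have mg := ae_measurable_rnormB (has_bochner_integral_strongly_measurable gw) fs.
  have dM0 : 0 <= dl * M by rewrite mulr_ge0// ltW.
  have H := bochner_integral_estimate chiv fu mg (fun=> rnorm_nonneg _) dM0.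
  apply: le_trans (H _) _.
    move=> t; rewrite (le_trans (rnorm_dist_triangle (chi t *: s t) _ _))//.
    rewrite -scalerBr -scalerBl !rnormZ rnorm_character// mul1r lerD2l.
    apply: ler_pM; rewrite ?rnorm_nonneg//; exact: Hq.
  by rewrite EFinD leeD// ?lee_fin// ltW.
pose B : set (borel G) := [set t : G | s (y + t) <> s t].
have fsy := finite_valued_translate y fs.
have mB : measurable B.
  exact: (finite_valued_preimage (fun p => p.2 <> p.1) (finite_valued_pair fs fsy)).
have fuy := finite_valued_translate y fu.
have mB_le : fine (m B) <= e / (8 * M).
  by rewrite -lee_fin fineK// fin_num_measure.
(* By invariance this integral is twice that of [u]. Off [B] the two values of [s] agree, and
   [q t + q (y + t)] is within [2 * dl] of [chi t + chi (y + t) = 0]; on [B] each summand has norm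
   at most [2 * M]. *)
have : rnorm (simple_integral m (u \+ (fun t : G => u (y + t)))) <=
    2 * (dl * M) + 4 * M * fine (m B).
  apply: rnorm_simple_integral_le_indic => //.
  - exact: (finite_valued_comp (fun p => p.1 + p.2) (finite_valued_pair fu fuy)).
  - by rewrite mulr_ge0// mulr_ge0// ltW.
  - by rewrite mulr_ge0// ltW.
  move=> t; rewrite indicE /=.
  have [Bt|Bt] := pselect (B t).
    rewrite mem_set// mulr1 (le_trans (rnorm_triangle _ _))//.
    rewrite (@le_trans _ _ (2 * M + 2 * M))//.
      by rewrite /u !rnormZ lerD// ler_pM ?rnorm_nonneg.
    by rewrite -mulrDl -natrD lerDr mulr_ge0// mulr_ge0// ltW.
  rewrite memNset// mulr0 addr0.
  have syt : s (y + (t : G)) = s t by apply: contrapT.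
  rewrite /u syt -scalerDl rnormZ mulrA.
  apply: ler_pM; rewrite ?rnorm_nonneg//.
  have -> : q t + q (y + (t : G)) = (q t - chi t : C^o) + (q (y + (t : G)) - chi (y + (t : G)) : C^o).
    by rewrite chiD chiy mulN1r opprK addrACA addNr addr0.
  rewrite (le_trans (rnorm_triangle _ _))// mulr_natl mulr2n lerD// rnorm_distC; exact: Hq.
rewrite simple_integralD// simple_integral_translate// -[X in rnorm X]mulr2n -[X in rnorm X]scaler_nat rnormZ.
have -> : rnorm (2%:R : C^o) = 2.
  by rewrite -(rmorph_nat (real_complex R)) rnorm_realC.
have -> : 2 * (dl * M) + 4 * M * fine (m B) = 2 * (dl * M + 2 * M * fine (m B)).
  by rewrite mulrDr !mulrA -natrM.
rewrite ler_pM2l// => H.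
have -> : e = (e / 4 + e / 4) + (e / 4 + e / 4) by rewrite -!mulrDl -!mulr2n; field.
rewrite -[v](subrK (simple_integral m u)) (le_trans (rnorm_triangle _ _))// lerD//.
rewrite (le_trans H)// lerD//.
rewrite (@le_trans _ _ (2 * M * (e / (8 * M))))//.
  by rewrite ler_wpM2l// mulr_ge0// ltW.
rewrite le_eqVlt; apply/orP; left; apply/eqP; field.
by rewrite gt_eqF.
Unshelve. all: by end_near. Qed.

End riemann_lebesgue.

(** * The L_p norm of a bounded function on a probability space *)

Section Lnorm_bound.
Context (R : realType) d (T : measurableType d) (P : probability T R).

Lemma Lnorm_le_cst (p : \bar R) (f : T -> R) (c : R) : (1 <= p)%E ->
  (forall t, 0 <= f t <= c) -> (Lnorm P p (EFin \o f) <= c%:E)%E.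
Proof.
move=> p1 fc; have c0 : 0 <= c by have /andP[] := fc point; exact: le_trans.
rewrite unlock; case: p p1 => [r| |//] r1.
- have r0 : 0 < r by rewrite (lt_le_trans ltr01).
  apply: (@le_trans _ _ (((c `^ r)%:E) `^ r^-1)%E).
    apply: gt0_ler_poweR.
    + by rewrite invr_ge0 ltW.
    + by rewrite in_itv/= leey andbT; apply: integral_ge0 => t _; rewrite lee_fin powR_ge0.
    + by rewrite in_itv/= leey andbT lee_fin powR_ge0.
    apply: (@le_trans _ _ (\int[P]_t (c `^ r)%:E)%E).
      apply: ge0_integral_mono => t; first by rewrite poweR_ge0.
      have /andP[ft0 ftc] := fc t.
      by rewrite /= ger0_norm// lee_fin ge0_ler_powR// ?nnegrE ?ltW.
    rewrite integral_cst// -[leRHS]mule1; apply: lee_wpmul2l.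
      by rewrite lee_fin powR_ge0.
    exact: probability_le1.
  by rewrite poweR_EFin -powRrM mulfV ?gt_eqF// powRr1.
- case: ifPn => _; last by rewrite lee_fin.
  apply/ess_sup_inf.ess_supP; apply: aeW => t /=.
  by have /andP[ft0 ftc] := fc t; rewrite ger0_norm// lee_fin.
Qed.

End Lnorm_bound.

(** * Unit vectors and truncation in c0 *)

Section c0_basis.
Context (R : realType).
Local Notation C := (Cplx R).

Lemma c0_seq_rnormP (u : nat -> C) : u \in c0_seq (K := C) <->
  forall e : R, 0 < e -> \forall n \near \oo, rnorm (u n : C^o) < e.
Proof.
split => [/(c0_seqP (K:=C))/(@cvg_rnormP R C^o) H e /H|H].
  by apply: filterS => n; rewrite subr0.
apply/(c0_seqP (K:=C))/(@cvg_rnormP R C^o) => e /H.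
by apply: filterS => n; rewrite subr0.
Qed.

Lemma c0_unit_subproof (k : nat) : (fun n => (n == k)%:R : C) \in c0_seq (K := C).
Proof.
apply/c0_seq_rnormP => e e0; exists k.+1 => // n /= kn.
by rewrite gtn_eqF// rnorm_zero.
Qed.

Definition c0_unit (k : nat) : c0 C := C0 (c0_unit_subproof k).

Lemma c0_norm_unit k : 1 <= c0_norm (c0_unit k).
Proof.
apply: le_trans (le_c0_norm _ k).
by rewrite /= eqxx /rnorm normr1.
Qed.

(** Since [u] tends to [0], its tails are small in norm; thus the unit vectors span a dense subspace
    of c0. *)
Lemma c0_truncation (u : c0 C) (N n : nat) :
  (u - \sum_(k < N) u k *: c0_unit k) n = if (n < N)%N then 0 else u n.
Proof.
have -> : (u - \sum_(k < N) u k *: c0_unit k) n =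
    u n - \sum_(k < N) u k * (n == k)%:R.
  rewrite [LHS](_ : _ = u n - (\sum_(k < N) u k *: c0_unit k) n)//; congr (_ - _).
  elim/big_ind2 : _ => [//|x a y b <- <-|//].
  by [].
case: ltnP => nN.
  rewrite (bigD1 (Ordinal nN))//= eqxx mulr1 big1 ?addr0 ?subrr// => i.
  by rewrite -val_eqE/= eq_sym => /negbTE ->; rewrite mulr0.
by rewrite big1 ?subr0// => i _; rewrite gtn_eqF ?mulr0// (leq_trans (ltn_ord i)).
Qed.

End c0_basis.

(** * Images under [T] of weighted sequences of characters *)

Section c0_series.
Context (R : realType) (G : topologicalZmodType) (m : probability (borel G) R).
Hypothesis m_haar : is_haar m.
Hypothesis cG : compact [set: G].
Context (X : completeNormedModType (Cplx R)).
Local Notation C := (Cplx R).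
Context (T : {linear c0 C -> X}) (c2 : R) (h : nat -> G -> C) (w : nat -> R).
Hypothesis T_le : forall y, rnorm (T y) <= c2 * c0_norm y.
Hypothesis c2_gt0 : 0 < c2.
Hypothesis h_char : forall k, is_character (h k).
Hypothesis w_cvg0 : w @ \oo --> (0 : R).
Hypothesis w_le1 : forall k, 0 <= w k <= 1.

Lemma rnorm_weighted k t : rnorm ((w k)%:C%C * h k t : C^o) = w k.
Proof.
by have /andP[w0 _] := w_le1 k; rewrite rnormM rnorm_realC// rnorm_character// mulr1.
Qed.

Lemma c0_weighted_subproof (t : G) : (fun k => (w k)%:C%C * h k t) \in c0_seq (K := C).
Proof.
apply/c0_seq_rnormP => e e0.
move/cvgrPdist_lt : w_cvg0 => /(_ e e0); apply: filterS => k.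
rewrite rnorm_weighted sub0r normrN; apply: le_lt_trans; exact: ler_norm.
Qed.

(** With [w k] equal to exp (- sigma lambda_k), the function [T (c0_weighted t)] of [t] will
    represent D_sigma. *)
Definition c0_weighted (t : G) : c0 C := C0 (c0_weighted_subproof t).

Lemma rnorm_T_weighted t : rnorm (T (c0_weighted t)) <= c2.
Proof.
rewrite (le_trans (T_le _))// -[leRHS]mulr1 ler_pM2l//.
by apply: c0_norm_le => k; rewrite rnorm_weighted; have /andP[] := w_le1 k.
Qed.

(** The predicate [b] marks the indices with [h k = gamma]; it will be [pred1 n] or [pred0], so that
    one argument serves for coefficients at the h_n and at all other characters. Truncated at [N],
    the function is a trigonometric polynomial whose unmarked terms integrate to [0], and the error
    is uniformly at most [c2] times the supremum of a tail of [w]. *)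
Lemma uniform_integral_T_weighted (gamma : G -> C) (b : pred nat) (v : X) (N0 : nat) :
  is_character gamma ->
  (forall k, if b k then forall t, h k t = gamma t else exists t, h k t != gamma t) ->
  (forall N, (N0 <= N)%N ->
     \sum_(k < N) (if b k then (w k)%:C%C *: T (c0_unit R k) else 0) = v) ->
  uniform_integral m (fun t : G => (gamma t)^* *: T (c0_weighted t)) v.
Proof.
move=> gC hb hv; apply: uniform_integral_limit => e e0.
have e20 : 0 < e / c2 by rewrite divr_gt0.
move/cvgrPdist_lt : w_cvg0 => /(_ _ e20)[N1 _ HN1].
pose N := maxn N0 N1.
exists (fun t : G => \sum_(k < N) ((gamma t)^* * h k t) *: ((w k)%:C%C *: T (c0_unit R k))).
exists v; split; last by rewrite subrr rnorm_zero ltW.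
- rewrite -(hv N); last exact: leq_maxl.
  apply: (@uniform_integral_sum _ _ _ _ m _ _ (fun (k : 'I_N) (t : G) =>
    ((gamma t)^* * h k t) *: ((w k)%:C%C *: T (c0_unit R k)))) => k.
  case: (b k) (hb k) => [hk|[y hy]].
    rewrite (_ : (fun t => _) = (fun=> (w k)%:C%C *: T (c0_unit R k))).
      exact: uniform_integral_cst.
    by apply/funext => t; rewrite hk character_mul_conj// scale1r.
  apply: (uniform_integral_character_eq0 m_haar cG (y := y)).
    exact: is_character_conj_mul.
  apply: contra hy => /eqP/(congr1 (fun z => gamma y * z)).
  by rewrite mulrA [gamma y * _]mulrC character_mul_conj// mul1r mulr1 => ->.
- move=> t.
  (* The polynomial comes from [T] of the truncated sequence, so the error comes from [T] of the
     tail. *)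
  have -> : \sum_(k < N) ((gamma t)^* * h k t) *: ((w k)%:C%C *: T (c0_unit R k)) =
      (gamma t)^* *: T (\sum_(k < N) c0_weighted t k *: c0_unit R k).
    rewrite linear_sum scaler_sumr; apply: eq_bigr => k _.
    by rewrite [T (_ *: _)]linearZZ/= !scalerA -mulrA [h k t * _]mulrC.
  rewrite -scalerBr -linearB rnormZ rnorm_conjC rnorm_character// mul1r.
  rewrite (le_trans (T_le _))// mulrC -ler_pdivlMr//.
  apply: c0_norm_le => n; rewrite c0_truncation; case: ltnP => nN.
    by rewrite rnorm_zero ltW.
  rewrite /= rnorm_weighted.
  have := HN1 n (leq_trans (leq_maxr _ _) nN).
  rewrite sub0r normrN => /ltW; apply: le_trans; exact: ler_norm.
Qed.

Lemma bochner_Lp_T_weighted (p : \bar R) : (1 <= p)%E ->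
  strongly_measurable m (fun t : G => T (c0_weighted t)) ->
  bochner_Lp m p (fun t : G => T (c0_weighted t)) /\
  (bochner_norm m p (fun t : G => T (c0_weighted t)) <= c2%:E)%E.
Proof.
move=> p1 mF.
have H : (bochner_norm m p (fun t : G => T (c0_weighted t)) <= c2%:E)%E.
  apply: Lnorm_le_cst => // t; rewrite rnorm_nonneg; exact: rnorm_T_weighted.
by split => //; split => //; exact: le_lt_trans H (ltry _).
Qed.

End c0_series.

(** * Characters attached to frequencies *)

Section frequency_characters.
Context (R : realType) (G : topologicalZmodType) (beta : R -> G).
Local Notation C := (Cplx R).

Lemma additive_0 : {morph beta : s t / s + t} -> beta 0 = 0.
Proof.
move=> betaD; apply: (addrI (beta 0)).
by rewrite addr0 -betaD addr0.
Qed.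

(** After half a period of the frequency [a - b], the quotient of the two characters is exp (- i pi)
    = -1. This separates distinct frequencies and supplies the translations for the Riemann-Lebesgue
    estimate. *)
Lemma freq_character_opp (a b t : R) (ga gb : G -> C) :
  is_freq_character beta a ga -> is_freq_character beta b gb ->
  (a - b) * t = pi -> ga (beta t) = - gb (beta t).
Proof.
move=> [_ gaE] [_ gbE] abt; rewrite gaE gbE.
have -> : a * t = b * t + pi by rewrite -abt; ring.
by rewrite cosDpi sinDpi; apply/eqP; rewrite eq_complex/= !eqxx.
Qed.

Lemma freq_character_neq (a b : R) (ga gb : G -> C) : a != b ->
  is_freq_character beta a ga -> is_freq_character beta b gb ->
  exists t : G, ga t != gb t.
Proof.
move=> ab aga bgb; exists (beta (pi / (a - b))).
rewrite (freq_character_opp aga bgb); last by rewrite mulrC divfK// subr_eq0.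
rewrite eq_sym -addr_eq0 -mulr2n mulrn_eq0/=.
by rewrite -normr_eq0; have [[_ _ ->] _] := bgb; exact: oner_neq0.
Qed.

(** The set where two continuous functions differ is open, and here it misses the dense range of
    [beta]. *)
Lemma freq_character_unique (a : R) (ga gb : G -> C) : dense (range beta) ->
  is_freq_character beta a ga -> is_freq_character beta a gb ->
  forall t, ga t = gb t.
Proof.
move=> dbeta [[cga _ _] gaE] [[cgb _ _] gbE] t; apply/eqP; rewrite -subr_eq0.
apply: contrapT => gab.
pose f (z : G) := rnorm (ga z - gb z : C^o).
have cf : continuous f.
  move=> z; apply: (@cvg_rnorm R C^o); apply: (@cvgB C C^o); [exact: cga|exact: cgb].
have ft : 0 < f t.
  rewrite lt_def rnorm_nonneg andbT; apply/eqP => /(@rnorm_eq0 R C^o) H.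
  by apply: gab; apply/eqP.
have [] := dbeta [set z | 0 < f z].
- by exists t.
- by apply: (open_comp (D := [set x : R | 0 < x])) => //; exact: open_gt.
- by move=> z [/= fz [s _ sz]]; move: fz; rewrite -sz /f gaE gbE subrr rnorm_zero ltxx.
Qed.

End frequency_characters.

(** Positive elements of the complex field are real, so the two constants may be replaced by their
    real parts. *)
Lemma contains_copyP (R : realType) (X Y : normedModType (Cplx R)) :
  contains_copy Y X -> exists (T : {linear Y -> X}) (c1 c2 : R),
    [/\ 0 < c1, 0 < c2 & forall y, c1 * rnorm y <= rnorm (T y) <= c2 * rnorm y].
Proof.
move=> [T [c1 [c2 [c10 c20 H]]]].
have E c : 0 < c -> ((complex.Re c)%:C)%C = c by move=> c0; rewrite RRe_real// gtr0_real.
exists T, (complex.Re c1), (complex.Re c2); split.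
- by rewrite -ltcR E.
- by rewrite -ltcR E.
- move=> y; have [H1 H2] := H y.
  by apply/andP; split; rewrite -lecR rmorphM/= !rnormE E.
Qed.

(** * The series with coefficients [T e_k] *)

Theorem mainTheorem2 (R : realType) (lambda : nat -> R)
    (X : completeNormedModType (Cplx R))
    (G : topologicalZmodType) (beta : R -> G) (m : probability (borel G) R)
    (lambda_freq : is_frequency lambda)
    (G_dirichlet : is_lambda_dirichlet_group lambda beta)
    (m_haar : is_haar m) :
  (exists2 p : \bar R, (1 <= p)%E &
     Hp (X := X) lambda beta m p = Hp_plus lambda beta m p) ->
  ~ contains_copy (c0 (Cplx R)) X.
Proof.
move=> [p p1 HpE] /contains_copyP[T [c1 [c2 [c10 c20 TB]]]].
have [lambda_incr lambda_ge0 lambda_oo] := lambda_freq.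
have [[cG _ cbeta betaD dbeta] /choice[h hP]] := G_dirichlet.
have hC k : is_character (h k) by have [] := hP k.
have T_le y : rnorm (T y) <= c2 * c0_norm y by have /andP[] := TB y.
pose a k : X := T (c0_unit R k).
have a_ge k : c1 <= rnorm (a k).
  have /andP[+ _] := TB (c0_unit R k); apply: le_trans.
  by rewrite -[leLHS]mulr1 ler_pM2l//; exact: c0_norm_unit.
have lambda_inj i j : i != j -> lambda i != lambda j.
  by rewrite neq_ltn => /orP[] /lambda_incr; [move/lt_eqF|move/gt_eqF] => ->.
have aplus : Hp_plus lambda beta m p a.
  (* The bound [c2] is the same for all [sigma], as the supremum in [Hp_plus_norm] requires. *)
  have repr sigma : 0 < sigma -> exists2 f, Hp_representative lambda beta m p (translate lambda sigma a) f &
      (bochner_norm m p f <= c2%:E)%E.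
    move=> s0; pose w k := expR (- (sigma * lambda k)).
    have w1 k : 0 <= w k <= 1.
      by rewrite expR_ge0/= -expR0 ler_expR oppr_le0 mulr_ge0// ltW.
    have w0 : w @ \oo --> (0 : R).
      apply: (@cvg_comp _ _ _ (fun k => sigma * lambda k) (fun x : R => expR (- x)) _ +oo);
        last exact: cvgr_expR.
      apply/cvgryPgt => A; move/cvgryPgt : lambda_oo => /(_ (A / sigma)).
      by apply: filterS => k; rewrite ltr_pdivrMr// mulrC.
    pose f (t : G) := T (c0_weighted hC w0 w1 t).
    have coefE (gamma : G -> Cplx R) n : is_freq_character beta (lambda n) gamma ->
        uniform_integral m (fun t : G => (gamma t)^* *: f t) (translate lambda sigma a n).
      (* Only the index [n] is marked, because distinct frequencies have distinct characters; [n.+1]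
         terms suffice to reach it. *)
      move=> gP; apply: (@uniform_integral_T_weighted _ _ _ m_haar cG _ _ _ _ _ T_le c20 _ _ _ _ (pred1 n) _ n.+1).
      - by case: gP.
      - move=> k /=; case: eqP => [->|/eqP kn].
          exact: (freq_character_unique dbeta (hP n) gP).
        exact: (freq_character_neq (lambda_inj _ _ kn) (hP k) gP).
      - move=> N nN; rewrite (bigD1 (Ordinal nN))//= eqxx big1 ?addr0// => i.
        by rewrite -val_eqE/= => /negbTE ->.
    have coef0 (gamma : G -> Cplx R) : is_character gamma ->
        (forall n, ~ is_freq_character beta (lambda n) gamma) ->
        uniform_integral m (fun t : G => (gamma t)^* *: f t) 0.
      move=> gC gN.
      apply: (@uniform_integral_T_weighted _ _ _ m_haar cG _ _ _ _ _ T_le c20 _ _ _ _ pred0 _ 0%N) => //.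
        move=> k /=; apply: contrapT => Hk; apply: (gN k).
        have -> : gamma = h k; last exact: hP.
        by apply/funext => t; apply: contrapT => gt; apply: Hk; exists t; apply/eqP => /esym.
      by move=> N _; rewrite big1.
    (* Strong measurability is read off the integral of [f] itself, its coefficient at the trivial
       character, whether or not that character is one of the h_n. *)
    have mf : strongly_measurable m f.
      have -> : f = (fun t : G => (1 : Cplx R)^* *: f t).
        by apply/funext => t; rewrite conjC1 scale1r.
      have [[n fn]|fN] := pselect (exists n, is_freq_character beta (lambda n) (fun=> 1)).
        exact: has_bochner_integral_strongly_measurable
          (uniform_integral_has_bochner_integral (coefE _ n fn)).
      apply: (has_bochner_integral_strongly_measurable (v := 0)).
      apply: uniform_integral_has_bochner_integral.
      apply: (coef0 (fun=> 1)); first exact: is_character_cst1.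
      by move=> n fn; apply: fN; exists n.
    have [fLp fle] := bochner_Lp_T_weighted T_le c20 p1 mf.
    exists f => //; split; last by move=> n g /coefE; exact: bochner_integralE.
    by split => // gamma gC gN; apply: bochner_integralE; exact: coef0.
  split; first by move=> sigma /repr[f fr _]; exists f.
  apply: (@le_lt_trans _ _ c2%:E); last exact: ltry.
  apply: ge_ereal_sup => _ [sigma /repr[f fr fc] <-].
  by apply: le_trans fc; apply: ereal_inf_lbound; exists f.
move: aplus; rewrite -HpE => -[f [_ fa]].
(* The norm of [a n] is at least [c1], so this coefficient is not the default value [0]. *)
have f_int n : has_bochner_integral m (fun t : G => (h n t)^* *: f t) (a n).
  rewrite -(fa n (h n) (hP n)); apply: bochner_integral_neq0.
  rewrite -/(fourier_coef m f (h n)) (fa n (h n) (hP n)).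
  by apply/eqP => a0; have := a_ge n; rewrite a0 rnorm_zero leNgt c10.
have small : \forall n \near \oo, rnorm (a n) <= c1 / 2.
  have c120 : 0 < c1 / 2 by rewrite divr_gt0.
  (* Here [g] is (h_0)^* f; with [chi] equal to (h_n)^* h_0, the product [chi *: g] is (h_n)^* f,
     whose integral is [a n]. *)
  have nb := near0_bochner_integral_character m_haar cG (f_int 0%N) c120.
  have tn : (fun n => pi / (lambda n - lambda 0%N)) @ \oo --> (0 : R).
    apply/cvgrPdist_lt => e e0.
    move/cvgryPgt : lambda_oo => /(_ (lambda 0%N + pi / e)); apply: filterS => n.
    have pie : 0 < pi / e :> R by rewrite divr_gt0// pi_gt0.
    rewrite -ltrBrDl => ln; have l0 := lt_trans pie ln.
    rewrite sub0r normrN ger0_norm; last by rewrite divr_ge0 ?pi_ge0// ltW.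
    by rewrite ltr_pdivrMr// mulrC -ltr_pdivrMr.
  have bt : (fun n => beta (pi / (lambda n - lambda 0%N))) @ \oo --> (0 : G).
    rewrite -(additive_0 betaD); apply: continuous_cvg => //; exact: cbeta.
  (* The index [0] is excluded: there the denominator vanishes, the quotient is [0] by convention,
     and no sign changes. *)
  move: (bt _ nb) (nbhs_infty_gt 0); apply: (@filterS2 _ \oo) => n /= H n0.
  apply: (H _ _ (is_character_conj_mul (hC n) (hC 0%N))).
    rewrite -[h 0%N _]opprK -(freq_character_opp (hP n) (hP 0%N)).
      by rewrite mulrN character_mul_conj.
    by rewrite mulrC divfK// subr_eq0 lambda_inj// -lt0n.
  rewrite (_ : (fun t => _) = (fun t : G => (h n t)^* *: f t)); first exact: f_int.
  apply/funext => t; rewrite scalerA -mulrA [h 0%N t * _]mulrC.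
  by rewrite character_mul_conj// mulr1.
have [n _ /(_ n (leqnn n))] := small.
rewrite leNgt => /negP; apply; apply: lt_le_trans (a_ge n).
by rewrite ltr_pdivrMr// mulr_natr mulr2n ltrDl.
Qed.
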